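(* $\{c_{pqr}(k):\ 3\le p<q<r \text{ primes},\ k\ge 0\}=\mathbb Z$, where $c_{pqr}(k)$ is the coefficient of $x^k$ in $\Psi_{pqr}(x)$.
   Context: $\Phi_n(x)$ is the $n$-th cyclotomic polynomial and $\Psi_n(x)=(x^n-1)/\Phi_n(x)=\sum_k c_n(k)x^k\in\mathbb Z[x]$, with $c_n(k)=0$ for $k>n-\varphi(n)$. *)

(* Defs.v *)
From mathcomp Require Import all_boot all_order all_algebra all_field.

Set Implicit Arguments.
Unset Strict Implicit.
Unset Printing Implicit Defensive.

Import GRing.Theory.
Local Open Scope ring_scope.

(* Division in {poly int} is a pseudo-division in general; it is exact here
   because 'Phi_n is monic and divides 'X^n - 1, see inv_CyclotomicK. *)
Definition inv_Cyclotomic (n : nat) : {poly int} := ('X^n - 1) %/ 'Phi_n.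

Notation "''Psi_' n" := (inv_Cyclotomic n)
  (at level 8, n at level 2, format "''Psi_' n").

Lemma inv_CyclotomicK (n : nat) : (0 < n)%N -> 'Psi_n * 'Phi_n = 'X^n - 1.
Proof.
move=> n_gt0; rewrite /inv_Cyclotomic -(prod_Cyclotomic n_gt0).
rewrite (big_rem n) -?dvdn_divisors //= mulrC.
by rewrite (Pdiv.IdomainMonic.mulKp (Cyclotomic_monic n)).
Qed.

(* Main.v *)
(* From Psi_pqr(x) = Phi_pq(x) (x^(qr) - 1) (1 + x^r + ... + x^((p-1)r)) one sees
   that, up to sign, the coefficients of Psi_pqr are sums of coefficients of
   Phi_pq along progressions of step r; and the k-th coefficient of Phi_pq is
   [k in S] - [k-1 in S], where S is the numerical semigroup generated by p
   and q. If r = q mod p and p(r - q) <= q, then jr lies in S for j < p, while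
   jr - 1 (resp. jr + 1) is not in S as long as no e <= j satisfies eq = 1
   (resp. eq = -1) mod p. One of these two conditions holds for all j < p/2, so
   Phi_pq is constant, equal to 1 or -1, on more than p/2 - 1 terms of the
   progression, and its partial sums, taken with both signs, reach every integer
   of absolute value < p/2. Such q and r exist for every p: otherwise each dyadic
   interval would contain at most 2p^2 primes, contradicting the lower bound
   2^n <= binomial(2n, n) <= (2n)^pi(2n). *)
Require Import Defs.
From mathcomp Require Import all_boot all_order all_algebra all_field.
From mathcomp Require Import zify ring.

Set Implicit Arguments.
Unset Strict Implicit.
Unset Printing Implicit Defensive.

Import GRing.Theory.

(** * Chebyshev's lower bound for the number of primes *)

(** Legendre's formula, whose terms with p^k > n vanish; the free cutoff [m] lets n! and (2n)! be
    expanded over the same range. *)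
Lemma logn_fact_widen p m n : prime p -> n < p ^ m ->
  logn p n`! = \sum_(1 <= k < m) n %/ p ^ k.
Proof.
move=> p_pr lt_n_pm.
have m_gt0 : 0 < n -> 0 < m by case: m lt_n_pm; lia.
have widen a b : n < p ^ a -> 0 < a -> a <= b ->
    \sum_(1 <= k < b) n %/ p ^ k = \sum_(1 <= k < a) n %/ p ^ k.
  move=> lt_n_pa a_gt0 le_ab.
  rewrite (@big_cat_nat _ _ _ a 1 b) //= -[RHS]addn0; congr (_ + _).
  rewrite big_nat big1 // => i /andP[le_ai _]; apply: divn_small.
  by apply: leq_trans lt_n_pa _; rewrite leq_exp2l ?prime_gt1.
rewrite logn_fact //; case: n lt_n_pm m_gt0 widen => [|n] lt_n_pm m_gt0 widen.
  by rewrite big_geq // big1 // => k _; rewrite div0n.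
have lt_n : n.+1 < p ^ n.+2.
  by apply: leq_trans (ltn_expl _ (prime_gt1 p_pr)) _; rewrite leq_exp2l ?prime_gt1.
by case/orP: (leq_total m n.+2) => le_mn; first rewrite (widen m) ?m_gt0 //;
  rewrite -(widen n.+2 m).
Qed.

(** Each k with p^k <= 2n adds floor(2n/p^k) - 2 floor(n/p^k) <= 1 to the valuation, so the exponent
    is at most [L], the integer part of log_p(2n). *)
Lemma pfactor_central_bin_leq p n : prime p -> 0 < n ->
  p ^ logn p 'C(n.*2, n) <= n.*2.
Proof.
move=> p_pr n_gt0; have p_gt1 := prime_gt1 p_pr.
have n2_gt0 : 0 < n.*2 by rewrite double_gt0.
have /= /andP[le_pL lt_pL] := trunc_log_bounds p_gt1 n2_gt0.
set L := trunc_log p n.*2 in le_pL lt_pL.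
apply: leq_trans le_pL; rewrite leq_exp2l //.
have le_nn2 : n <= n.*2 by lia.
have := congr1 (logn p) (bin_fact le_nn2).
have -> : n.*2 - n = n by lia.
rewrite !lognM ?muln_gt0 ?fact_gt0 ?bin_gt0 //.
rewrite !(@logn_fact_widen p L.+1) //; last by apply: leq_ltn_trans lt_pL.
have : \sum_(1 <= k < L.+1) n.*2 %/ p ^ k <=
       \sum_(1 <= k < L.+1) (n %/ p ^ k + n %/ p ^ k + 1).
  by apply: leq_sum => k _; rewrite -addnn leq_divDl.
by rewrite !big_split /= sum_nat_const_nat; lia.
Qed.

Lemma central_bin_leq n : 0 < n ->
  'C(n.*2, n) <= n.*2 ^ size (primes 'C(n.*2, n)).
Proof.
move=> n_gt0; have C_gt0 : 0 < 'C(n.*2, n) by rewrite bin_gt0; lia.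
rewrite {1}(prod_prime_decomp C_gt0) prime_decompE big_map /=.
apply: (@leq_trans (\prod_(p <- primes 'C(n.*2, n)) n.*2)).
  rewrite !big_seq; apply: leq_prod => p.
  by rewrite mem_primes => /and3P[p_pr _ _]; apply: pfactor_central_bin_leq.
by rewrite big_const_seq count_predT iter_muln_1.
Qed.

(** Each step at least doubles: C(2n+2, n+1) = 2 C(2n+1, n) and (n+1) C(2n+1, n) = (2n+1) C(2n,
    n). *)
Lemma central_bin_geq n : 2 ^ n <= 'C(n.*2, n).
Proof.
elim: n => // n IHn; rewrite doubleS.
have := mul_bin_diag n.*2.+2 n; rewrite /= => diag.
have := mul_bin_down n.*2.+1 n; rewrite /= => down.
rewrite expnS; nia.
Qed.

Lemma mem_primes_central_bin p n :
  p \in primes 'C(n.*2, n) -> prime p /\ p <= n.*2.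
Proof.
rewrite mem_primes => /and3P[p_pr _ p_dvd]; split=> //.
rewrite leqNgt; apply/negP => lt_np.
have le_nn2 : n <= n.*2 by lia.
have : 0 < logn p (n.*2)`!.
  by rewrite logn_gt0 mem_primes p_pr fact_gt0 -(bin_fact le_nn2) dvdn_mulr.
by rewrite (@logn_fact_widen p 1) ?expn1 // big_geq.
Qed.

(** * Close congruent primes by pigeonhole *)

(** This makes the primes outnumber the pigeonholes below. It holds because 2^(32p) = (2^(8p))^4 >=
    (8p+1)^4, which exceeds twice the left side. *)
Lemma exp2_gt_quadratic p : 0 < p ->
  (32 * p) * ((32 * p).+1 * (p * p.*2)) < 2 ^ (32 * p).-1.
Proof.
move=> p_gt0; set s := 8 * p.
have lt_s : s.+1 <= 2 ^ s by apply: ltn_expl.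
have h4 : s.+1 ^ 4 <= 2 ^ (32 * p).
  have -> : 32 * p = s * 4 by rewrite /s; lia.
  by rewrite expnM leq_exp2r.
have : 2 * 2 ^ (32 * p).-1 = 2 ^ (32 * p) by rewrite -expnS prednK //; lia.
suff : 2 * ((32 * p) * ((32 * p).+1 * (p * p.*2))) < s.+1 ^ 4 by lia.
rewrite -muln2 (_ : 32 * p = 4 * s); last by rewrite /s; lia.
rewrite (_ : s.+1 ^ 4 = (s.+1 * s.+1) * (s.+1 * s.+1)); last by rewrite !expnS expn0; lia.
have h1 : 64 * (p * p) <= s.+1 * s.+1 by rewrite /s; nia.
have h2 : 4 * s * (4 * s).+1 < 16 * (s.+1 * s.+1) by nia.
set A := 4 * s * _ in h2; set B := s.+1 * s.+1 in h1 h2 *.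
have -> : 2 * (4 * s * ((4 * s).+1 * (p * (p * 2)))) = 4 * (p * p) * A by rewrite /A; lia.
nia.
Qed.

(* Pigeonhole: [key] takes at most (m + 1) * 2p^2 values on [1, 2 ^ m], and
   Chebyshev's lower bound gives more primes than that. *)
Lemma exists_close_primes_modn p : 0 < p -> exists q r,
  [/\ prime q, prime r, q < r, r = q %[mod p] & p * (r - q) <= q].
Proof.
move=> p_gt0; set m := 32 * p; set n := 2 ^ m.-1.
have n2E : n.*2 = 2 ^ m by rewrite /n -mul2n -expnS prednK // /m; lia.
have n_gt0 : 0 < n by rewrite expn_gt0.
set s := primes 'C(n.*2, n).
(* The dyadic interval [2^a, 2^(a+1)) of q, its residue mod p, and its position among p equal pieces
   of that interval. Equal keys give p |q - r| < 2^a <= q. *)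
pose key q := (trunc_log 2 q, (q %% p, p * q %/ 2 ^ trunc_log 2 q)).
have big_s : m.+1 * (p * p.*2) < size s.
  (* As 2n = 2^m, the bound 2^n <= (2n)^(size s) reads n <= m * size s. *)
  have := leq_trans (central_bin_geq n) (central_bin_leq n_gt0).
  rewrite -/s n2E -expnM leq_exp2l // => le_n.
  have := exp2_gt_quadratic p_gt0; rewrite -/m -/n => lt_n.
  by have := leq_trans lt_n le_n; rewrite ltn_mul2l => /andP[].
have s_pos q : q \in s -> 0 < q.
  by case/mem_primes_central_bin => /prime_gt0.
have key_box : {subset map key s <=
    [seq (a, bc) | a <- iota 0 m.+1,
       bc <- [seq (b, c) | b <- iota 0 p, c <- iota 0 p.*2]]}.
  move=> _ /mapP[q s_q ->]; have q_gt0 := s_pos q s_q.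
  case: (mem_primes_central_bin s_q) => _; rewrite n2E => le_q.
  have le_q2 := trunc_logP (isT : 1 < 2) q_gt0.
  have := trunc_log_ltn q (isT : 1 < 2); rewrite expnS => lt_q2.
  apply/allpairsPdep; exists (key q).1, (key q).2; split=> //.
    by rewrite mem_iota add0n /= ltnS -(@leq_exp2l 2) // (leq_trans le_q2).
  apply/allpairsPdep; exists (key q).2.1, (key q).2.2; split=> //; rewrite mem_iota add0n /=.
    by rewrite ltn_mod.
  by rewrite ltn_divLR ?expn_gt0 // -muln2 -mulnA ltn_pmul2l.
have : ~~ uniq (map key s).
  apply: contraL big_s => key_uniq; rewrite -leqNgt.
  have := uniq_leq_size key_uniq key_box.
  by rewrite !size_allpairs !size_iota size_map.
have close q r : q \in s -> q < r -> key q = key r ->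
    r = q %[mod p] /\ p * (r - q) <= q.
  move=> s_q lt_qr [eq_log -> ]; rewrite -eq_log => eq_div; split=> //.
  have /= /andP[le_q2 _] := trunc_log_bounds (isT : 1 < 2) (s_pos q s_q).
  set d := 2 ^ _ in eq_div le_q2.
  have d_gt0 : 0 < d by rewrite expn_gt0.
  have := divn_eq (p * q) d; have := divn_eq (p * r) d.
  have := ltn_pmod (p * q) d_gt0; have := ltn_pmod (p * r) d_gt0.
  rewrite eq_div mulnBr; lia.
move=> not_uniq; have : ~ {in s &, injective key}.
  by move=> inj; move: not_uniq; rewrite map_inj_in_uniq // primes_uniq.
case: (boolP [exists q : 'I_n.*2.+1, [exists r : 'I_n.*2.+1,
   [&& val q \in s, val r \in s, q < r & key q == key r]]]).
  case/existsP => q /existsP[r /and4P[s_q s_r lt_qr /eqP eq_key]] _.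
  exists q, r; have [? ?] := close _ _ s_q lt_qr eq_key.
  by split=> //; [case/mem_primes_central_bin: s_q | case/mem_primes_central_bin: s_r].
move=> no_pair []; move=> q r s_q s_r eq_key.
have lt_ord x : x \in s -> x < n.*2.+1 by case/mem_primes_central_bin.
have absurd x y : x \in s -> y \in s -> x < y -> key x = key y -> False.
  move=> s_x s_y lt_xy eq_xy; case/negP: no_pair.
  apply/existsP; exists (Ordinal (lt_ord x s_x)).
  apply/existsP; exists (Ordinal (lt_ord y s_y)).
  by apply/and4P; split; rewrite //= eq_xy.
case: (ltngtP q r) => // lt_qr; exfalso.
  exact: (absurd q r).
exact: (absurd r q).
Qed.

Local Open Scope ring_scope.

(** * Factorization of Psi_pqr *)

Lemma perm_divisors_mul_prime n r : (0 < n)%N -> prime r -> ~~ (r %| n)%N ->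
  perm_eq (divisors (n * r)) (divisors n ++ [seq (d * r)%N | d <- divisors n]).
Proof.
move=> n_gt0 r_pr rNn; have r_gt0 := prime_gt0 r_pr.
have nr_gt0 : (0 < n * r)%N by rewrite muln_gt0 n_gt0.
apply: uniq_perm; first exact: divisors_uniq.
  rewrite cat_uniq divisors_uniq map_inj_uniq ?divisors_uniq ?andbT /=; last first.
    by move=> a b /eqP; rewrite eqn_pmul2r // => /eqP.
  apply/hasPn => _ /mapP[d _ ->]; rewrite /= -dvdn_divisors //.
  by apply: contra rNn; apply: dvdn_trans; rewrite dvdn_mull.
move=> d; rewrite mem_cat -!dvdn_divisors //.
apply/idP/orP => [d_dvd | [d_dvd | /mapP[e]]]; last 2 first.
- exact: dvdn_mulr.
- by rewrite -dvdn_divisors // => e_dvd ->; rewrite dvdn_pmul2r.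
case: (boolP (r %| d)%N) => [/dvdnP[e d_e] | rNd]; [right | left].
  apply/mapP; exists e; rewrite // -dvdn_divisors //.
  by rewrite -(dvdn_pmul2r r_gt0) -d_e.
by rewrite -(@Gauss_dvdl _ _ r) // coprime_sym prime_coprime.
Qed.

(** For a prime r not dividing n this is (X^(nr) - 1)/(X^n - 1). Composite second arguments arise
    when primes are peeled off n. *)
Definition new_factors (n r : nat) : {poly int} :=
  \prod_(d <- divisors n) 'Phi_(d * r).

Lemma Xn_sub_1_mul_prime n r : (0 < n)%N -> prime r -> ~~ (r %| n)%N ->
  'X^(n * r) - 1 = ('X^n - 1) * new_factors n r.
Proof.
move=> n_gt0 r_pr rNn.
rewrite -!prod_Cyclotomic ?muln_gt0 ?n_gt0 ?prime_gt0 //.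
by rewrite (perm_big _ (perm_divisors_mul_prime n_gt0 r_pr rNn)) big_cat big_map.
Qed.

Lemma new_factors_mul_prime n r m : (0 < n)%N -> prime r -> ~~ (r %| n)%N ->
  new_factors (n * r) m = new_factors n m * new_factors n (r * m).
Proof.
move=> n_gt0 r_pr rNn; rewrite /new_factors.
rewrite (perm_big _ (perm_divisors_mul_prime n_gt0 r_pr rNn)) big_cat big_map.
by congr (_ * _); apply: eq_bigr => d _; rewrite mulnA.
Qed.

Lemma new_factors1 m : new_factors 1 m = 'Phi_m.
Proof. by rewrite /new_factors big_seq1 mul1n. Qed.

Lemma new_factors_prime p m : prime p -> new_factors p m = 'Phi_m * 'Phi_(p * m).
Proof.
move=> p_pr; have pN1 : ~~ (p %| 1)%N by rewrite dvdn1 gtn_eqF ?prime_gt1.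
by rewrite -[p in LHS]mul1n new_factors_mul_prime // !new_factors1.
Qed.

Lemma Xn_sub_1_prime p : prime p -> 'X^p - 1 = ('X - 1) * 'Phi_p :> {poly int}.
Proof.
move=> p_pr; have pN1 : ~~ (p %| 1)%N by rewrite dvdn1 gtn_eqF ?prime_gt1.
by rewrite -[p in LHS]mul1n Xn_sub_1_mul_prime // new_factors1 expr1.
Qed.

Lemma Xn_sub_1_neq0 n : (0 < n)%N -> 'X^n - 1 != 0 :> {poly int}.
Proof. by move=> n_gt0; rewrite -size_poly_eq0 size_XnsubC. Qed.

Lemma prime_ndvd p q : prime p -> prime q -> p != q -> ~~ (p %| q)%N.
Proof. by move=> p_pr q_pr neq; rewrite dvdn_prime2. Qed.

Lemma Xn_sub_1_geometric n r :
  'X^(n * r) - 1 = ('X^r - 1) * \sum_(j < n) 'X^(j * r) :> {poly int}.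
Proof.
rewrite mulnC exprM subrX1; congr (_ * _).
by apply: eq_bigr => j _; rewrite -exprM mulnC.
Qed.

Section DistinctPrimes.

Variables p q : nat.
Hypotheses (p_pr : prime p) (q_pr : prime q) (neq_pq : p != q).

(** The classical quotient formula for Phi_pq, cross-multiplied to avoid division. *)
Lemma Cyclotomic_pq_cross :
  'Phi_(p * q) * ('X^p - 1) * ('X^q - 1) = ('X - 1) * ('X^(p * q) - 1).
Proof.
have qNp : ~~ (q %| p)%N by rewrite prime_ndvd // eq_sym.
rewrite Xn_sub_1_mul_prime ?prime_gt0 // new_factors_prime //.
by rewrite (Xn_sub_1_prime q_pr); ring.
Qed.

Lemma Cyclotomic_pq_geometric :
  'Phi_(p * q) * ('X^p - 1) = ('X - 1) * \sum_(j < p) 'X^(j * q).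
Proof.
apply: (mulIf (Xn_sub_1_neq0 (prime_gt0 q_pr))).
by rewrite Cyclotomic_pq_cross Xn_sub_1_geometric; ring.
Qed.

Lemma inv_Cyclotomic_pqr r : prime r -> p != r -> q != r ->
  'Psi_(p * q * r) =
  'Phi_(p * q) * ('X^(q * r) - 1) * \sum_(j < p) 'X^(j * r).
Proof.
move=> r_pr neq_pr neq_qr.
have [p_gt0 q_gt0 r_gt0] :=
  And3 (prime_gt0 p_pr) (prime_gt0 q_pr) (prime_gt0 r_pr).
have rNp : ~~ (r %| p)%N by rewrite prime_ndvd // eq_sym.
have rNq : ~~ (r %| q)%N by rewrite prime_ndvd // eq_sym.
have qNp : ~~ (q %| p)%N by rewrite prime_ndvd // eq_sym.
have rNpq : ~~ (r %| p * q)%N by rewrite Euclid_dvdM // negb_or rNp.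
(* The factor X^r - 1 closes the geometric sum into X^(pr) - 1, and Phi_pqr turns Psi_pqr into
   X^(pqr) - 1; both sides then split into cyclotomic factors. *)
apply: (mulIf (Xn_sub_1_neq0 r_gt0)).
have PhiN0 : 'Phi_(p * q * r) != 0 by rewrite monic_neq0 ?Cyclotomic_monic.
apply: (mulIf PhiN0).
have Epqr := inv_CyclotomicK (n := p * q * r).
rewrite mulrAC Epqr ?muln_gt0 ?p_gt0 ?q_gt0 //.
rewrite [RHS](_ : _ = 'Phi_(p * q) * ('X^(p * r) - 1) * ('X^(q * r) - 1) *
  'Phi_(p * q * r)); last by rewrite (Xn_sub_1_geometric p r); ring.
rewrite (@Xn_sub_1_mul_prime (p * q) r) ?muln_gt0 ?p_gt0 //.
rewrite (Xn_sub_1_mul_prime p_gt0 r_pr) // (Xn_sub_1_mul_prime q_gt0 r_pr) //.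
rewrite new_factors_mul_prime // !new_factors_prime // (Xn_sub_1_prime r_pr) mulnA.
rewrite [RHS](_ : _ = ('Phi_(p * q) * ('X^p - 1) * ('X^q - 1)) *
  ('Phi_r ^+ 2 * 'Phi_(p * r) * 'Phi_(q * r) * 'Phi_(p * q * r))); last by ring.
by rewrite Cyclotomic_pq_cross; ring.
Qed.

End DistinctPrimes.

(** * Coefficients of Phi_pq and the numerical semigroup *)

(* The number of representations k = ip + jq with i >= 0 and 0 <= j < p: it is
   the indicator function of the numerical semigroup generated by p and q. *)
Definition semigroup_count (p q k : nat) : nat :=
  \sum_(j < p) ((j * q <= k)%N && (k == j * q %[mod p])).

(** As a power series, P is 1 - X times (sum_j X^(jq))/(1 - X^p), whose coefficients count
    representations. To stay within polynomials, recurrences of step p are compared instead. *)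
Lemma coef_eq_semigroup_count p q (P : {poly int}) :
    (0 < p)%N -> P * ('X^p - 1) = ('X - 1) * \sum_(j < p) 'X^(j * q) ->
  (forall k, P`_k.+1 = (semigroup_count p q k.+1)%:R - (semigroup_count p q k)%:R)
  /\ P`_0 = (semigroup_count p q 0)%:R.
Proof.
move=> p_gt0 mulP.
pose T k := (semigroup_count p q k)%:R : int.
pose b k : int := (\sum_(j < p) 'X^(j * q) : {poly int})`_k.
have bE k : b k = \sum_(j < p) (k == j * q)%N%:R.
  by rewrite /b coef_sum; apply: eq_bigr => j _; rewrite coefXn.
(* A representation of k either has i = 0, that is k = jq, or comes from one of k - p. *)
have TE k : T k = b k + (if (k < p)%N then 0 else T (k - p)%N).
  rewrite bE /T /semigroup_count natr_sum; case: ltnP => [lt_kp | le_pk].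
    rewrite addr0; apply: eq_bigr => j _; congr (_ %:R).
    case: (ltngtP k (j * q)) => // [lt_jk | ->]; last by rewrite eqxx.
    case: eqP => //= eq_mod; exfalso.
    have lt_jp : (j * q < p)%N by apply: ltn_trans lt_kp.
    by move: eq_mod lt_jk; rewrite !modn_small // => ->; rewrite ltnn.
  rewrite natr_sum -big_split /=; apply: eq_bigr => j _.
  rewrite -natrD; congr (_ %:R).
  have -> : (k - p == j * q %[mod p]) = (k == j * q %[mod p]).
    by rewrite -{2}(subnK le_pk) modnDr.
  case: (ltngtP k (j * q)) => [lt_kj | lt_jk | eq_k].
  - by rewrite (_ : (j * q <= k - p)%N = false) //; lia.
  - case: eqP => eq_mod; rewrite ?andbF //= andbT.
    suff -> : (j * q <= k - p)%N by [].
    have : (p %| k - j * q)%N by rewrite -eqn_mod_dvd 1?ltnW //; apply/eqP.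
    by move/dvdn_leq; rewrite subn_gt0 => /(_ lt_jk); lia.
  - by rewrite (_ : (j * q <= k - p)%N = false) ?eq_k ?eqxx //; lia.
have coef k : P`_k = b k - (if k is k'.+1 then b k' else 0)
                     + (if (k < p)%N then 0 else P`_(k - p)).
  have := congr1 (fun R : {poly int} => R`_k) mulP.
  rewrite /= mulrBr mulr1 mulrBl mul1r !coefB coefMXn -/(b k) coefXM.
  have -> : (if k == 0%N then 0 else (\sum_(j < p) 'X^(j * q) : {poly int})`_k.-1) =
            (if k is k'.+1 then b k' else 0) by case: k.
  by move=> e; rewrite -[LHS](subKr (if (k < p)%N then 0 else P`_(k - p))) e; ring.
have PE k : P`_k = T k - (if k is k'.+1 then T k' else 0).
  elim/ltn_ind: k => k IH; rewrite coef TE; case: ltnP => [lt_kp | le_pk].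
    case: k lt_kp {IH} => [|k] lt_kp; first by ring.
    by rewrite (TE k) (ltnW lt_kp); ring.
  rewrite IH; last by lia.
  case: k le_pk {IH} => [|k] le_pk; first by lia.
  rewrite (TE k); case: (ltnP k p) => [lt_kp | le_pk'].
    have -> : (k.+1 - p = 0)%N by lia.
    by ring.
  by rewrite subSn //; ring.
by split=> [k|]; rewrite PE ?subr0.
Qed.

(** * Coefficients of Phi_pq at jr and jr + 1 *)

Section CloseCongruentPrimes.

Variables p q r : nat.
Hypotheses (p_pr : prime p) (q_pr : prime q) (r_pr : prime r).
Hypotheses (p_ge3 : (3 <= p)%N) (lt_pq : (p < q)%N) (lt_qr : (q < r)%N).
Hypotheses (eq_mod : r = q %[mod p]) (close : (p * (r - q) <= q)%N).

Let neq_pq : p != q. Proof. by rewrite neq_ltn lt_pq. Qed.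
Let neq_pr : p != r. Proof. by rewrite neq_ltn (ltn_trans lt_pq). Qed.
Let neq_qr : q != r. Proof. by rewrite neq_ltn lt_qr. Qed.

(** Together with [close] this gives p^2 <= q. *)
Lemma close_primes_gap : (p <= r - q)%N.
Proof.
apply: dvdn_leq; first by rewrite subn_gt0.
by rewrite -eqn_mod_dvd 1?ltnW //; apply/eqP.
Qed.

Lemma mul_modn_close i : i * r = i * q %[mod p].
Proof. by rewrite -modnMmr eq_mod modnMmr. Qed.

(** If j > i, then jq >= iq + q >= iq + p(r - q) >= ir + (r - q) >= ir + p > ir + 1. *)
Lemma mul_leq_close i j : (i < p)%N -> (j * q <= (i * r).+1)%N -> (j <= i)%N.
Proof.
move=> lt_ip le_jq; rewrite leqNgt; apply/negP => lt_ij.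
have gap := close_primes_gap.
have : (i.+1 * q <= j * q)%N by rewrite leq_mul2r lt_ij orbT.
have : (i * r = i * q + i * (r - q))%N by rewrite -mulnDr subnKC // ltnW.
have : (i.+1 * (r - q) <= p * (r - q))%N by rewrite leq_mul2r lt_ip orbT.
rewrite !mulSn; lia.
Qed.

(** Since ir = iq + i(r - q) with p dividing r - q, j = i gives a representation; any other j would
    be congruent to i mod p. *)
Lemma semigroup_count_mul i : (i < p)%N -> semigroup_count p q (i * r) = 1%N.
Proof.
move=> lt_ip; rewrite /semigroup_count (bigD1 (Ordinal lt_ip)) //= big1 => [|j].
  by rewrite leq_mul2l (ltnW lt_qr) orbT mul_modn_close eqxx.
move=> neq_ji; case: leqP => //= le_j; rewrite mul_modn_close.
have le_ji := mul_leq_close lt_ip (leqW le_j).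
case: eqP => // /eqP; rewrite eqn_mod_dvd ?leq_mul2r ?le_ji ?orbT // -mulnBl.
rewrite Euclid_dvdM // [(p %| q)%N](negbTE (prime_ndvd p_pr q_pr neq_pq)) orbF.
rewrite /dvdn modn_small; last by rewrite (leq_ltn_trans (leq_subr _ _)).
rewrite subn_eq0 => le_ij; case/eqP: neq_ji; apply: val_inj => /=.
by apply/eqP; rewrite eqn_leq le_ji.
Qed.

(** A representation of ir - 1 would have j <= i and jq = iq - 1 mod p, so e = i - j would satisfy
    eq = 1 mod p. *)
Lemma semigroup_count_mul_pred i : (0 < i < p)%N ->
    (forall e, (e <= i)%N -> e * q <> 1 %[mod p]) ->
  semigroup_count p q (i * r).-1 = 0%N.
Proof.
case/andP=> i_gt0 lt_ip not1; rewrite /semigroup_count big1 // => j _.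
have ir_gt0 : (0 < i * r)%N by rewrite muln_gt0 i_gt0 prime_gt0.
case: leqP => //= le_j; case: eqP => // eq_j.
have le_ji : (j <= i)%N by apply: mul_leq_close => //; lia.
case: (not1 (i - j)%N); first exact: leq_subr.
apply/eqP; rewrite -(eqn_modDl (j * q)) -mulnDl subnKC // addn1.
by rewrite -mul_modn_close -[X in X == _ %[mod p]](prednK ir_gt0) -addn1 -modnDml
  eq_j modnDml addn1.
Qed.

(** Likewise e = i - j would satisfy eq = -1 mod p, written as divisibility of eq + 1. *)
Lemma semigroup_count_mul_succ i : (i < p)%N ->
    (forall e, (e <= i)%N -> ~~ (p %| (e * q).+1)%N) ->
  semigroup_count p q (i * r).+1 = 0%N.
Proof.
move=> lt_ip not1; rewrite /semigroup_count big1 // => j _.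
case: leqP => //= le_j; case: eqP => // eq_j.
have le_ji : (j <= i)%N by apply: mul_leq_close.
case/negP: (not1 (i - j)%N (leq_subr _ _)).
rewrite -[X in (_ %| X)%N]subn0 -eqn_mod_dvd // -(eqn_modDl (j * q)) addn0.
rewrite addnS -mulnDl subnKC // -eq_j -addn1.
by rewrite -[X in _ == X %[mod p]]addn1 eqn_modDr mul_modn_close.
Qed.

Lemma Cyclotomic_pq_coef :
  (forall k, 'Phi_(p * q)`_k.+1 =
     (semigroup_count p q k.+1)%:R - (semigroup_count p q k)%:R)
  /\ 'Phi_(p * q)`_0 = (semigroup_count p q 0)%:R.
Proof.
apply: coef_eq_semigroup_count (prime_gt0 p_pr) _.
exact: Cyclotomic_pq_geometric.
Qed.

Lemma Cyclotomic_pq_coef_mul i : (i < p)%N ->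
    (forall e, (e <= i)%N -> e * q <> 1 %[mod p]) ->
  'Phi_(p * q)`_(i * r) = 1.
Proof.
move=> lt_ip not1; have [coefS coef0] := Cyclotomic_pq_coef.
case: (posnP i) => [i0 | i_gt0].
  by rewrite i0 mul0n coef0 -[X in semigroup_count _ _ X](mul0n r)
    semigroup_count_mul // prime_gt0.
have ir_gt0 : (0 < i * r)%N by rewrite muln_gt0 i_gt0 prime_gt0.
rewrite -(prednK ir_gt0) coefS prednK // semigroup_count_mul //.
by rewrite semigroup_count_mul_pred ?i_gt0 // subr0.
Qed.

Lemma Cyclotomic_pq_coef_mul_succ i : (i < p)%N ->
    (forall e, (e <= i)%N -> ~~ (p %| (e * q).+1)%N) ->
  'Phi_(p * q)`_(i * r).+1 = -1.
Proof.
move=> lt_ip not1; have [-> _] := Cyclotomic_pq_coef.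
by rewrite semigroup_count_mul // semigroup_count_mul_succ // sub0r.
Qed.

(** * Coefficients of Psi_pqr as partial sums *)

Lemma inv_Cyclotomic_pqr_coef k :
  'Psi_(p * q * r)`_k = \sum_(j < p)
    ((if (k < (q + j) * r)%N then 0 else 'Phi_(p * q)`_(k - (q + j) * r)) -
     (if (k < j * r)%N then 0 else 'Phi_(p * q)`_(k - j * r))).
Proof.
rewrite inv_Cyclotomic_pqr // -mulrA mulr_sumr mulr_sumr coef_sum.
apply: eq_bigr => j _.
by rewrite mulrBl mul1r -exprD mulrBr coefB !coefMXn mulnDl.
Qed.

(** Because s < r, exactly the shifts j <= i contribute, each with the coefficient at (i - j)r +
    s. *)
Lemma sum_coef_mul_const (s i : nat) (v : int) : (s < r)%N -> (i < p)%N ->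
    (forall j, (j <= i)%N -> 'Phi_(p * q)`_(j * r + s) = v) ->
  \sum_(j < p) (if (i * r + s < j * r)%N then 0
                else 'Phi_(p * q)`_(i * r + s - j * r)) = i.+1%:R * v.
Proof.
move=> lt_sr lt_ip coef_v.
rewrite (eq_bigr (fun j : 'I_p => if (j < i.+1)%N then v else 0)) => [|j _].
  rewrite -big_mkcond /= -(big_ord_widen _ (fun=> v)) // sumr_const card_ord.
  by rewrite mulr_natl.
rewrite ltnS; case: (leqP j i) => [le_ji | lt_ij].
  rewrite ltnNge (leq_trans _ (leq_addr _ _)) ?leq_mul2r ?le_ji ?orbT //=.
  rewrite -addnBAC ?leq_mul2r ?le_ji ?orbT // -mulnBl coef_v //.
  exact: leq_subr.
suff -> : (i * r + s < j * r)%N by [].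
have : (i.+1 * r <= j * r)%N by rewrite leq_mul2r lt_ij orbT.
by rewrite mulSn; lia.
Qed.

(** The positive copies of Phi_pq start at degree qr > ir + s, so only the negative ones are
    seen. *)
Lemma inv_Cyclotomic_pqr_coef_low (s i : nat) (v : int) : (s < r)%N -> (i < p)%N ->
    (forall j, (j <= i)%N -> 'Phi_(p * q)`_(j * r + s) = v) ->
  'Psi_(p * q * r)`_(i * r + s) = - (i.+1%:R * v).
Proof.
move=> lt_sr lt_ip coef_v; rewrite inv_Cyclotomic_pqr_coef sumrB.
rewrite (sum_coef_mul_const lt_sr lt_ip coef_v) big1 ?sub0r // => j _.
suff -> : (i * r + s < (q + j) * r)%N by [].
have : (i.+1 * r <= (q + j) * r)%N by rewrite leq_mul2r; lia.
by rewrite mulSn; lia.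
Qed.

(** The negative copies are read at indices at least pr, since p + j <= 2p <= p^2 <= q, and this is
    beyond the degree (p-1)(q-1) of Phi_pq. *)
Lemma inv_Cyclotomic_pqr_coef_high (s i : nat) (v : int) : (s < r)%N -> (i < p)%N ->
    (forall j, (j <= i)%N -> 'Phi_(p * q)`_(j * r + s) = v) ->
  'Psi_(p * q * r)`_((q + i) * r + s) = i.+1%:R * v.
Proof.
move=> lt_sr lt_ip coef_v; rewrite inv_Cyclotomic_pqr_coef sumrB.
rewrite [X in _ - X]big1 ?subr0 => [|j _].
  rewrite -(sum_coef_mul_const lt_sr lt_ip coef_v); apply: eq_bigr => j _.
  by rewrite !mulnDl -addnA ltn_add2l subnDl.
case: ifP => // _; apply: nth_default.
rewrite size_Cyclotomic totient_coprime ?totient_prime //; last first.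
  by rewrite prime_coprime // prime_ndvd.
have lt_jp := ltn_ord j; have gap := close_primes_gap.
have h1 : (p * p <= q)%N by apply: leq_trans close; rewrite leq_mul2l gap orbT.
have h2 : (p * r <= (q + i) * r + s - j * r)%N.
  have : ((p + j) * r <= (q + i) * r)%N by rewrite leq_mul2r; apply/orP; right; nia.
  by rewrite mulnDl; lia.
apply: leq_trans h2.
have : (p.-1 * q.-1 <= p * q.-1)%N by rewrite leq_mul2r leq_pred orbT.
have : (p * q.-1 < p * r)%N by rewrite ltn_mul2l; lia.
lia.
Qed.

End CloseCongruentPrimes.

(** * Realizing a given integer *)

Theorem theorem8 :
  forall z : int, exists p q r k : nat,
    [/\ [/\ prime p, prime q & prime r],
        [&& (3 <= p)%N, (p < q)%N & (q < r)%N]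
      & ('Psi_(p * q * r))`_k = z].
Proof.
move=> z; case: (posnP `|z|%N) => [/eqP | z_gt0].
  (* Zero is read off past the degree; any admissible primes would do. *)
  rewrite absz_eq0 => /eqP->; exists 3%N, 5%N, 7%N, (size 'Psi_(3 * 5 * 7)).
  by split=> //; rewrite nth_default.
pose i := `|z|.-1%N; have iS : i.+1 = `|z|%N by rewrite prednK.
have [p lt_p p_pr] := prime_above (i.*2 + 2).
have [q [r [q_pr r_pr lt_qr eq_mod close]]] :=
  exists_close_primes_modn (prime_gt0 p_pr).
have p_ge3 : (3 <= p)%N by lia.
have lt_ip : (i < p)%N by lia.
have gap := close_primes_gap lt_qr eq_mod.
have lt_pq : (p < q)%N by nia.
have r_gt1 := prime_gt1 r_pr.
exists p, q, r.
suff [s [v [lt_sr v1 coef_v]]] : exists s (v : int), [/\ (s < r)%N,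
    v = 1 \/ v = -1 &
    forall j, (j <= i)%N -> 'Phi_(p * q)`_(j * r + s) = v].
  have low := inv_Cyclotomic_pqr_coef_low p_pr q_pr r_pr p_ge3 lt_pq lt_qr
    eq_mod close lt_sr lt_ip coef_v.
  have high := inv_Cyclotomic_pqr_coef_high p_pr q_pr r_pr p_ge3 lt_pq lt_qr
    eq_mod close lt_sr lt_ip coef_v.
  (* Whichever sign v has, the high and low coefficients provide both i + 1 and -(i + 1). *)
  have [-> | ->] : z = i.+1%:R * v \/ z = - (i.+1%:R * v) by case: v1 => ->; lia.
    by exists ((q + i) * r + s)%N; rewrite p_ge3 lt_pq lt_qr.
  by exists (i * r + s)%N; rewrite p_ge3 lt_pq lt_qr.
(* As 2i < p, the residues 1 and -1 mod p cannot both be of the form e * q with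
   e <= i; if 1 is, use the coefficients at jr + 1, otherwise those at jr. *)
case: (boolP [exists e : 'I_i.+1, e * q == 1 %[mod p]]) =>
    [/existsP[e /eqP e1] | no_e].
  exists 1%N, (-1); split=> // [|j le_ji]; first by right.
  rewrite addn1; apply: Cyclotomic_pq_coef_mul_succ => // [|e' le_e']; first by lia.
  apply/negP => e'1.
  have : (p %| (e + e') * q)%N.
    rewrite /dvdn mulnDl -modnDml e1 modnDml add1n; exact: e'1.
  rewrite Euclid_dvdM // [(p %| q)%N](negbTE (prime_ndvd _ _ _)) ?neq_ltn ?lt_pq //.
  rewrite orbF => /dvdn_leq; have := ltn_ord e.
  case: (posnP e) e1 => [-> | e_gt0 _]; last by lia.
  by rewrite mul0n mod0n modn_small //; lia.
exists 0%N, 1; split=> // [||j le_ji]; [by lia | by left |].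
rewrite addn0; apply: Cyclotomic_pq_coef_mul => // [|e le_ej e1]; first by lia.
have lt_ei : (e < i.+1)%N by lia.
by case/existsP: no_e; exists (Ordinal lt_ei); apply/eqP.
Qed.
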